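(* Let $F$ be a finite metric subspace of the infinite-dimensional Hilbert space $\mathcal H$. Let all isometric embeddings of $F$ into $\mathcal H$ be coloured using finitely many colours. Then for every finite collection $Y$ of such embeddings and every $\varepsilon>0$ there is a collection of embeddings $Y'$ congruent to $Y$ and monochromatic up to $\varepsilon$.
   Context: $\mathcal H$ carries the norm distance. The set of all isometric embeddings of $F$ into $\mathcal H$ carries the metric $d_{\sup}(i,j)=\max\{\|i(x)-j(x)\| : x\in F\}$. A colouring with finitely many colours is a finite partition $\gamma$ of this set; a collection of embeddings is monochromatic up to $\varepsilon$ if it is contained in the $\varepsilon$-neighbourhood of some $A\in\gamma$. A collection $Y'$ is congruent to $Y$ if $Y'=\{g\circ j : j\in Y\}$ for some isometry $g$ of $\mathcal H$ onto itself. *)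

(* Defs.v *)
From mathcomp Require Import all_boot all_order all_algebra.
From mathcomp Require Import finmap.
From mathcomp Require Import all_classical all_reals all_analysis.

Set Implicit Arguments.
Unset Strict Implicit.
Unset Printing Implicit Defensive.

Import Order.TTheory GRing.Theory Num.Theory.
Import numFieldNormedType.Exports.

Local Open Scope classical_set_scope.
Local Open Scope ring_scope.

Definition infinite_dimensional (R : realType) (V : lmodType R) : Prop :=
  ~ exists (n : nat) (b : 'I_n -> V),
      forall x : V, exists c : 'I_n -> R, x = \sum_(i < n) c i *: b i.

(* On a complete normed space this says that it is a Hilbert space whose inner
   product is [ip]: the given norm is the one [ip] induces. *)
Definition induces_norm (R : realType) (H : normedModType R)
    (ip : {dot H for (idfun : R -> R)}) : Prop :=
  forall x : H, ip x x = `|x| ^+ 2.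

(* Distance-preserving and onto; linearity is not required, so translations
   are included. *)
Definition onto_isometry (R : realType) (H : normedModType R)
    (g : H -> H) : Prop :=
  (forall x y : H, `|g x - g y| = `|x - y|) /\ set_surj setT setT g.

Section Embeddings.
Variables (R : realType) (H : normedModType R) (F : {fset H}).

Definition embeddings : set {ffun F -> H} :=
  [set i | forall x y : F, `|i x - i y| = `|val x - val y|].

(* The values are nonnegative, so starting the maximum at 0 only matters for
   empty [F]. *)
Definition d_sup (i j : {ffun F -> H}) : R :=
  \big[Num.max/0]_(x : F) `|i x - j x|.

Definition neighbourhood (e : R) (A : set {ffun F -> H}) :
    set {ffun F -> H} :=
  [set j | embeddings j /\ exists2 i, A i & d_sup i j < e].

Definition finite_colouring (gamma : set (set {ffun F -> H})) : Prop :=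
  finite_set gamma /\ partition gamma id embeddings.

Definition monochromatic_up_to (gamma : set (set {ffun F -> H})) (e : R)
    (Y : set {ffun F -> H}) : Prop :=
  exists2 A, gamma A & Y `<=` neighbourhood e A.

Definition congruent (Y Y' : set {ffun F -> H}) : Prop :=
  exists2 g : H -> H, onto_isometry g &
    Y' = [set [ffun x => g (j x)] | j in Y].

End Embeddings.

Arguments embeddings {R H} F.

(* Main.v *)
Require Import Defs.
From mathcomp Require Import all_boot all_order all_algebra.
From mathcomp Require Import finmap.
From mathcomp Require Import all_classical all_reals all_analysis.
From mathcomp Require Import lra ring.

(** The theorem is an instance of concentration of measure.

    All the points involved lie in a finite-dimensional subspace, so in
    coordinates [F] and the members of [Y] are congruent families in some [R^d].
    Call orthogonal maps rotations, whatever their determinant.  The linear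
    part of a congruence is a rotation, and the translation part is
    nearly one when [R^d] is placed at a large height [rho] in [R^(d + 1)]
    ([congruence_by_rotation]).  So there is a rotation [G l] of [R^(d + 1)] for
    each member [j l] of [Y], taking [F] to [j l] up to a small error.

    The orthonormal sum of [N] copies of [R^(d + 1)], scaled by [1 / sqrt N],
    lies in the Hilbert space.  A word of [N] rotations yields an embedding of
    [F], acting on block [i] by its [i]-th letter, so the colouring of
    embeddings becomes a colouring of words.  The same word also moves every
    [j l] isometrically, and the result is close to the embedding of [F]
    given by the word whose letters are multiplied by [G l].

    If the letters were drawn from Haar measure, multiplication by [G l] would
    preserve the measure on words.  A finite substitute suffices: multiplication
    by [G l] agrees, up to a small error, with a bijection of a largest
    separated set of rotations; the bijection comes from the marriage theorem
    ([rotation_matching], [hall_matching]).  One colour class has mass bounded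
    below independently of [N], and a second-moment bound for the Hamming
    distance to this class shows that almost all words are within [delta N] of
    it ([concentration]).  Hence for large [N] some word has all its images under
    the bijections near the class ([monochromatic_word]); as words differing in
    few letters give nearby embeddings, the members of [Y] moved by this word
    are all near one colour ([word_estimate]).

    This motion is defined only on finitely many points; a product of
    reflections extends it to an isometry of the whole space onto itself
    ([isometry_extension]). *)

Set Implicit Arguments.
Unset Strict Implicit.
Unset Printing Implicit Defensive.

Import Order.TTheory GRing.Theory Num.Theory.
Import numFieldNormedType.Exports.

Local Open Scope ring_scope.

(** * Matchings in finite bipartite graphs *)

Section Hall.
Variables A B : finType.
Implicit Types (r : {set A * B}) (S : {set A}).

Definition nbrs (r : {set A * B}) (S : {set A}) : {set B} :=
  [set b | [exists a in S, (a, b) \in r]].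

Lemma mem_nbrs r (S : {set A}) a b : a \in S -> (a, b) \in r -> b \in nbrs r S.
Proof. by move=> aS abr; rewrite inE; apply/existsP; exists a; rewrite aS. Qed.

Definition hall_condition r := forall S : {set A}, (#|S| <= #|nbrs r S|)%N.

(** A violation can only come from [a] losing its neighbour [b]; every other
    incidence survives the deletion. *)
Lemma hall_violator r a b S : hall_condition r ->
    (#|nbrs (r :\ (a, b)) S| < #|S|)%N ->
  [/\ a \in S, nbrs r (S :\ a) \subset nbrs (r :\ (a, b)) S
    & nbrs r [set a] :\ b \subset nbrs (r :\ (a, b)) S].
Proof.
move=> hall ltS.
have aS : a \in S.
  apply: contraLR ltS => aS; rewrite -leqNgt (leq_trans (hall S)) //.
  apply/subset_leq_card/fintype.subsetP => y; rewrite inE => /exists_inP[x xS xyr].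
  apply: mem_nbrs (xS) _; rewrite !inE xyr andbT.
  by apply/eqP => -[xa _]; rewrite -xa xS in aS.
split=> //; apply/fintype.subsetP => y.
  rewrite inE => /exists_inP[x]; rewrite !inE => /andP[xa xS] xyr.
  apply/exists_inP; exists x => //; rewrite !inE xyr andbT.
  by apply/eqP => -[/eqP]; rewrite (negPf xa).
rewrite !inE => /andP[yb /exists_inP[x]]; rewrite inE => /eqP-> ayr.
apply/exists_inP; exists a => //; rewrite !inE ayr andbT.
by apply/eqP => -[/eqP]; rewrite (negPf yb).
Qed.

(** Rado's observation.  If neither deletion preserved the condition, take
    violators [S1] and [S2]: since [b1] and [b2] differ, their neighbourhoods
    [N1] and [N2] together cover all neighbours of the union, and both contain
    the neighbours of the intersection without [a].  Adding the condition for
    these two sets contradicts [#|N1| + #|N2| <= #|S1| + #|S2| - 2]. *)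
Lemma hall_prune r a b1 b2 : hall_condition r -> b1 != b2 ->
  hall_condition (r :\ (a, b1)) \/ hall_condition (r :\ (a, b2)).
Proof.
move=> hall b12.
have [/forallP h1|/forallPn[S1]] :=
  boolP [forall S : {set A}, #|S| <= #|nbrs (r :\ (a, b1)) S|]%N; first by left.
have [/forallP h2|/forallPn[S2]] :=
  boolP [forall S : {set A}, #|S| <= #|nbrs (r :\ (a, b2)) S|]%N; first by right.
rewrite -!ltnNge => lt2 lt1.
have [aS1 sub1 sub1a] := hall_violator hall lt1.
have [aS2 sub2 sub2a] := hall_violator hall lt2.
set N1 := nbrs _ S1 in lt1 sub1 sub1a; set N2 := nbrs _ S2 in lt2 sub2 sub2a.
have leU : (#|S1 :|: S2| <= #|N1 :|: N2|)%N.
  apply: leq_trans (hall _) (subset_leq_card _); apply/fintype.subsetP => y.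
  rewrite inE => /exists_inP[x xS xyr]; rewrite inE.
  have [xa|xa] := eqVneq x a.
    have ya : y \in nbrs r [set a] by apply: mem_nbrs xyr; rewrite inE xa.
    have [yb|yb] := eqVneq y b1.
      by rewrite (fintype.subsetP sub2a) ?orbT// inE ya andbT inE yb.
    by rewrite (fintype.subsetP sub1a)// inE ya andbT inE.
  by case/setUP: xS => xS; [rewrite (fintype.subsetP sub1)|rewrite (fintype.subsetP sub2) ?orbT];
     rewrite ?orbT//; apply: mem_nbrs xyr; rewrite !inE xa.
have leI : (#|(S1 :&: S2) :\ a| <= #|N1 :&: N2|)%N.
  apply: leq_trans (hall _) (subset_leq_card _); apply/fintype.subsetP => y.
  rewrite inE => /exists_inP[x xS xyr].
  have /and3P[xa xS1 xS2] : [&& x != a, x \in S1 & x \in S2].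
    by move: xS; rewrite !inE.
  rewrite inE (fintype.subsetP sub1) ?(fintype.subsetP sub2)//.
    by apply: mem_nbrs xyr; rewrite !inE xa.
  by apply: mem_nbrs xyr; rewrite !inE xa.
have := cardsUI N1 N2; have := cardsUI S1 S2.
have := cardsD1 a (S1 :&: S2); rewrite inE aS1 aS2 /= => eqI eqS eqN.
have : (#|S1| + #|S2| <= (#|N1| + #|N2|).+1)%N.
  by rewrite -eqS -eqN eqI addnA addn1 addSn ltnS leq_add.
by rewrite leqNgt -addSn -addnS leq_add.
Qed.

(** The marriage theorem.  Edges are pruned as long as some vertex of [A] has
    two neighbours; in the end each vertex has exactly one, and the condition on
    pairs makes the resulting function injective. *)
Lemma hall_matching r : hall_condition r ->
  exists2 f : A -> B, injective f & forall a, (a, f a) \in r.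
Proof.
have [n] := ubnP #|r|; elim: n r => // n IH r; rewrite ltnS => len hall.
have [/existsP[a /existsP[b1 /existsP[b2 /and3P[b12 ab1 ab2]]]]|uniq_nbr] :=
  boolP [exists a, exists b1, exists b2, [&& b1 != b2, (a, b1) \in r & (a, b2) \in r]].
  have prune b : (a, b) \in r -> hall_condition (r :\ (a, b)) ->
      exists2 f : A -> B, injective f & forall a, (a, f a) \in r.
    move=> abr /IH[|f finj fr].
      by move: len; rewrite (cardsD1 (a, b) r) abr.
    by exists f => // x; have := fr x; rewrite inE => /andP[].
  by case: (hall_prune a hall b12); apply: prune.
have nbr a : exists b, (a, b) \in r.
  have := hall [set a]; rewrite cards1 card_gt0 => /set0Pn[b].
  by rewrite inE => /exists_inP[x]; rewrite inE => /eqP-> abr; exists b.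
have uniq_b a b1 b2 : (a, b1) \in r -> (a, b2) \in r -> b1 = b2.
  move=> ab1 ab2; apply: contraNeq uniq_nbr => b12.
  by apply/existsP; exists a; apply/existsP; exists b1; apply/existsP; exists b2;
     rewrite b12 ab1.
have fr a : (a, xchoose (nbr a)) \in r := xchooseP (nbr a).
exists (fun a => xchoose (nbr a)) => // a a' eqf.
apply: contraTeq (hall [set a; a']) => aa'; rewrite cards2 aa' -ltnNge ltnS /=.
rewrite -(cards1 (xchoose (nbr a))); apply/subset_leq_card/fintype.subsetP => y.
rewrite !inE => /exists_inP[x]; rewrite !inE => /orP[]/eqP-> xy; apply/eqP.
  exact: uniq_b xy (fr _).
by rewrite eqf; exact: uniq_b xy (fr _).
Qed.

End Hall.

(** * Concentration of measure on words *)

Section Words.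
Variables (R : realFieldType) (P : finType).
Hypothesis P_gt0 : (0 < #|P|)%N.
Implicit Types (f : seq P -> R) (g h : P -> R) (s t : seq P).

Definition mean (g : P -> R) : R := (\sum_a g a) / #|P|%:R.

(** The expectation of [f] over a uniformly random word of length [n].  The
    recursion on the first letter makes conditioning on it definitional. *)
Fixpoint avg n f : R :=
  if n is n'.+1 then mean (fun a => avg n' (fun s => f (a :: s))) else f [::].

Let cP_gt0 : 0 < #|P|%:R :> R. Proof. by rewrite ltr0n. Qed.

Lemma meanD g h : mean (fun a => g a + h a) = mean g + mean h.
Proof. by rewrite /mean big_split mulrDl. Qed.

Lemma meanZ x g : mean (fun a => x * g a) = x * mean g.
Proof. by rewrite /mean -mulr_sumr mulrA. Qed.

Lemma mean_cst x : mean (fun=> x) = x.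
Proof.
rewrite /mean sumr_const -[_ *+ _]mulr_natr; apply: mulfK.
by rewrite gt_eqF.
Qed.

Lemma eq_mean g h : g =1 h -> mean g = mean h.
Proof. by move=> gh; rewrite /mean; congr (_ / _); apply: eq_bigr => a _. Qed.

Lemma le_mean g h : (forall a, g a <= h a) -> mean g <= mean h.
Proof. by move=> gh; rewrite ler_pM2r ?invr_gt0// ler_sum. Qed.

Lemma eq_avg n f f' : (forall s, size s = n -> f s = f' s) -> avg n f = avg n f'.
Proof.
elim: n f f' => [|n IH] f g fg /=; first exact: fg.
by apply: eq_mean => a; apply: IH => s sn; apply: fg; rewrite /= sn.
Qed.

Lemma le_avg n f f' : (forall s, size s = n -> f s <= f' s) -> avg n f <= avg n f'.
Proof.
elim: n f f' => [|n IH] f g fg /=; first exact: fg.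
by apply: le_mean => a; apply: IH => s sn; apply: fg; rewrite /= sn.
Qed.

Lemma avgD n f f' : avg n (fun s => f s + f' s) = avg n f + avg n f'.
Proof.
elim: n f f' => //= n IH f f'; rewrite -meanD.
by apply: eq_mean => a; exact: IH.
Qed.

Lemma avgZ n x f : avg n (fun s => x * f s) = x * avg n f.
Proof.
elim: n f => //= n IH f; rewrite -meanZ.
by apply: eq_mean => a; exact: IH.
Qed.

Lemma avg_cst n x : avg n (fun=> x) = x.
Proof.
elim: n => //= n IH; rewrite -[RHS]mean_cst.
by apply: eq_mean => a; exact: IH.
Qed.

Lemma avg_sum (I : finType) n (f : I -> seq P -> R) :
  avg n (fun s => \sum_i f i s) = \sum_i avg n (f i).
Proof.
elim: (index_enum I) => [|i r IH].
  by rewrite big_nil -[RHS](avg_cst n); apply: eq_avg => s _; rewrite big_nil.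
by rewrite big_cons -IH -avgD; apply: eq_avg => s _; rewrite big_cons.
Qed.

Lemma avg_map n (sigma : P -> P) f : injective sigma ->
  avg n (fun s => f (map sigma s)) = avg n f.
Proof.
move=> sinj; elim: n f => //= n IH f; rewrite /mean; congr (_ / _).
rewrite [RHS](reindex_inj sinj); apply: eq_bigr => a _.
exact: (IH (fun s => f (sigma a :: s))).
Qed.

Definition hamming s t : nat := count (fun p => p.1 != p.2) (zip s t).

Lemma hamming_cons a b s t : hamming (a :: s) (b :: t) = ((a != b) + hamming s t)%N.
Proof. by []. Qed.

Lemma hamming_refl s : hamming s s = 0%N.
Proof. by elim: s => // a s IH; rewrite hamming_cons IH eqxx. Qed.

Lemma hamming_triangle s t u : size s = size t -> size t = size u ->
  (hamming s u <= hamming s t + hamming t u)%N.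
Proof.
elim: s t u => [|a s IH] [|b t] [|c u] //= [st] [tu].
rewrite !hamming_cons addnACA leq_add ?IH//.
by have [->|_] := eqVneq a b; rewrite ?add0n //= (leq_trans (leq_b1 _)).
Qed.

Definition hamming_lipschitz n f := forall s t,
  size s = n -> size t = n -> `|f s - f t| <= (hamming s t)%:R.

(** Variance at most [1]: every value lies within [1] of the mean. *)
Lemma mean_variance_le (g : P -> R) : (forall a b, `|g a - g b| <= 1) ->
  mean (fun a => g a ^+ 2) <= mean g ^+ 2 + 1.
Proof.
move=> g1; set m := mean g.
have gm a : (g a - m) ^+ 2 <= 1.
  have le1 : m <= g a + 1.
    rewrite -[leRHS]mean_cst; apply: le_mean => b.
    by have := g1 a b; rewrite ler_norml => /andP[]; lra.
  have ge1 : g a - 1 <= m.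
    rewrite -[leLHS]mean_cst; apply: le_mean => b.
    by have := g1 a b; rewrite ler_norml => /andP[]; lra.
  by nra.
have /le_mean : forall a, g a ^+ 2 <= 1 - m ^+ 2 + (2 * m) * g a.
  by move=> a; have := gm a; nra.
rewrite meanD mean_cst meanZ -/m; nra.
Qed.

(** An Efron-Stein bound.  Conditioning on the first letter splits the variance
    into the mean conditional variance, bounded by induction, and the variance
    of the conditional mean, which varies by at most [1] with the letter. *)
Lemma avg_variance_le n f : hamming_lipschitz n f ->
  avg n (fun s => f s ^+ 2) <= avg n f ^+ 2 + n%:R.
Proof.
elim: n f => [|n IH] f lip /=; first by rewrite addr0.
pose m a := avg n (fun s => f (a :: s)).
have m1 a b : `|m a - m b| <= 1.
  have fab s : size s = n -> `|f (a :: s) - f (b :: s)| <= 1.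
    move=> sn; apply: le_trans (lip _ _ _ _) _; rewrite /= ?sn//.
    by rewrite hamming_cons hamming_refl addn0; case: (a != b) => /=; rewrite ?ler01.
  rewrite ler_norml; apply/andP; split.
    rewrite lerBrDr -{1}(avg_cst n (-1)) -avgD; apply: le_avg => s /fab.
    by rewrite ler_norml => /andP[]; lra.
  rewrite lerBlDr -{1}(avg_cst n 1) -avgD; apply: le_avg => s /fab.
  by rewrite ler_norml => /andP[]; lra.
have step a : avg n (fun s => f (a :: s) ^+ 2) <= m a ^+ 2 + n%:R.
  apply: IH => s t sn tn.
  apply: le_trans (lip _ _ _ _) _; rewrite /= ?sn ?tn//.
  by rewrite hamming_cons eqxx.
apply: le_trans (le_mean step) _; rewrite meanD mean_cst -/m.
have := mean_variance_le m1; rewrite -/m -natr1; lra.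
Qed.

Lemma avg_gt0_ex n f : 0 < avg n f -> exists t : n.-tuple P, 0 < f t.
Proof.
move=> favg.
have [/existsP//|/existsPn none] := boolP [exists t : n.-tuple P, 0 < f t].
move: favg; rewrite ltNge -[X in _ <= X](avg_cst n 0) => /negP[].
apply: le_avg => s /eqP sn; have := none (Tuple sn).
by rewrite -leNgt.
Qed.

Definition within_hamming n (delta : R) (B : pred (seq P)) s : bool :=
  [exists t : n.-tuple P, B t && ((hamming s t)%:R <= delta * n%:R)].

(** The Hamming distance [d] to [B] is Lipschitz, so its variance is at most
    [n]; it vanishes on a set of mass at least [1/k], which forces its mean to
    be at most [sqrt (k n)].  Markov's inequality for [d ^ 2] then bounds the
    mass of the words at distance more than [delta n] from [B]. *)
Lemma concentration n (B : pred (seq P)) (k delta : R) :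
    0 < k -> 0 < delta -> 1 <= k * avg n (fun s => (B s)%:R) ->
  avg n (fun s => (~~ within_hamming n delta B s)%:R) * (delta ^+ 2 * n%:R) <= k + 1.
Proof.
move=> k0 d0 Bk.
have [->|n0] := posnP n; first by rewrite !mulr0; lra.
have nR0 : 0 < n%:R :> R by rewrite ltr0n.
have [t0 Bt0] : exists t0 : n.-tuple P, B t0.
  have /avg_gt0_ex[t] : 0 < avg n (fun s => (B s)%:R) by nra.
  by rewrite ltr0n lt0b => Bt; exists t.
pose d s := hamming s [arg min_(t < t0 | B t) hamming s t].
have dle s (t : n.-tuple P) : B t -> (d s <= hamming s t)%N.
  by move=> Bt; rewrite /d; case: arg_minnP => // u Bu /(_ t Bt).
have dex s : exists2 t : n.-tuple P, B t & d s = hamming s t.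
  by rewrite /d; case: arg_minnP => // u Bu _; exists u.
pose f s : R := (d s)%:R.
have dtri s s' : size s = n -> size s' = n -> (d s <= hamming s s' + d s')%N.
  move=> sn s'n; have [t Bt ->] := dex s'.
  by apply: leq_trans (dle s t Bt) _; rewrite hamming_triangle// ?size_tuple ?sn.
have hammingC s s' : size s = size s' -> hamming s s' = hamming s' s.
  elim: s s' => [|a s IH] [|b s'] //= [ss']; rewrite !hamming_cons IH//.
  by rewrite eq_sym.
have lip : hamming_lipschitz n f.
  move=> s s' sn s'n; rewrite ler_norml /f.
  have := dtri _ _ sn s'n; have := dtri _ _ s'n sn.
  rewrite (hammingC s' s) ?sn// -!(ler_nat R) !natrD; lra.
have var := avg_variance_le lip.
set m := avg n f in var.
have fB s : size s = n -> B s -> f s = 0.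
  move=> /eqP sn Bs; have := dle s (Tuple sn) Bs.
  by rewrite /= hamming_refl leqn0 /f => /eqP->.
have m2 : m ^+ 2 <= k * n%:R.
  (* On [B] one has [m ^ 2 = (f - m) ^ 2]. *)
  have : m ^+ 2 * avg n (fun s => (B s)%:R) <= n%:R.
    rewrite -avgZ; apply: (@le_trans _ _ (avg n (fun s => f s ^+ 2 + ((- 2 * m) * f s + m ^+ 2)))).
      apply: le_avg => s sn; case: (boolP (B s)) => Bs.
        by rewrite (fB _ sn Bs) mulr1 mulr0 expr0n /= !add0r.
      by rewrite mulr0; have := sqr_ge0 (f s - m); nra.
    rewrite !avgD avgZ avg_cst -/m; nra.
  by move=> h; have := sqr_ge0 m; nra.
set q := avg n _.
have : q * (delta * n%:R) ^+ 2 <= m ^+ 2 + n%:R.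
  apply: le_trans var; rewrite mulrC -avgZ; apply: le_avg => s sn.
  case: (boolP (within_hamming _ _ _ _)) => [_|/existsPn far] /=.
    by rewrite mulr0 sqr_ge0.
  have [t Bt dt] := dex s; have := far t; rewrite Bt /= -ltNge -dt -/(f s) => dn.
  by rewrite mulr1 lerXn2r ?nnegrE ?ler0n// ?ltW// mulr_gt0.
move=> h; rewrite -(ler_pM2r nR0); nra.
Qed.

(** Some colour class has mass at least [1/K], so almost every word is near it.
    Applying an injective [sigma l] letter by letter preserves the measure,
    hence a random word has all its images near that class at once. *)
Lemma monochromatic_word (L : finType) (K : nat) (delta : R) n
    (col : seq P -> 'I_K) (sigma : L -> P -> P) :
    0 < delta -> #|L|%:R * (K%:R + 1) < delta ^+ 2 * n%:R ->
    (forall l, injective (sigma l)) ->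
  exists c, exists2 s, size s = n & forall l, exists t,
    [/\ size t = n, col t = c & (hamming (map (sigma l) s) t)%:R <= delta * n%:R].
Proof.
move=> d0 large sinj.
have K0 : 0 < K%:R :> R.
  by rewrite ltr0n; case: (K) (col [::]) => // -[].
have [c Kc] : exists c, 1 <= K%:R * avg n (fun s => (col s == c)%:R).
  apply/existsP; apply: contraT => /existsPn none.
  have : \sum_c K%:R * avg n (fun s => (col s == c)%:R) < \sum_(c < K) 1.
    apply: ltr_sum => [|c _]; last by rewrite ltNge none.
    by apply/hasP; exists (col [::]); rewrite ?mem_index_enum.
  rewrite -mulr_sumr -avg_sum sumr_const card_ord -{2}(mulr1 K%:R) => h.
  suff : avg n (fun s => \sum_c (col s == c)%:R) = 1 :> R.
    by move=> e; move: h; rewrite e mulr1 ltxx.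
  rewrite -[RHS](avg_cst n); apply: eq_avg => s _.
  rewrite (bigD1 (col s))//= eqxx big1 ?addr0// => i /negPf.
  by rewrite eq_sym => ->.
pose B s := col s == c.
have conc := concentration K0 d0 Kc.
set q := avg n _ in conc.
have q1 : #|L|%:R * q < 1.
  have dn0 : 0 < delta ^+ 2 * n%:R.
    by apply: le_lt_trans large; rewrite mulr_ge0// addr_ge0.
  rewrite -(ltr_pM2r dn0) mul1r; apply: le_lt_trans large.
  by rewrite -mulrA ler_wpM2l.
pose bad s : R := \sum_l (~~ within_hamming n delta B (map (sigma l) s))%:R.
have badq : avg n bad = #|L|%:R * q.
  rewrite avg_sum (eq_bigr (fun=> q)) => [|l _].
    by rewrite sumr_const mulr_natl.
  exact: (avg_map n (fun s => (~~ within_hamming n delta B s)%:R)).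
have /avg_gt0_ex[s] : 0 < avg n (fun s => 1 + (-1) * bad s).
  by rewrite avgD avgZ avg_cst badq; lra.
move=> sbad; exists c, s; first by rewrite size_tuple.
move=> l; have : within_hamming n delta B (map (sigma l) s).
  apply: contraTT sbad => far; rewrite -leNgt mulN1r subr_le0.
  by rewrite /bad (bigD1 l)//= far lerDl sumr_ge0// => i _; rewrite ler0n.
case/existsP => t /andP[/eqP tc tham]; exists t; split=> //.
by rewrite size_tuple.
Qed.

End Words.

Lemma hamming_sum (P : finType) n (x0 : P) (s t : seq P) : size s = n -> size t = n ->
  hamming s t = (\sum_(i < n) (nth x0 s i != nth x0 t i))%N.
Proof.
elim: n s t => [|n IH] [|a s] [|b t] //=; first by rewrite big_ord0.
by move=> [sn] [tn]; rewrite big_ord_recl hamming_cons (IH s t).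
Qed.

(** * Inner products and reflections *)

(** Both the inner product of the Hilbert space and the standard one on row
    vectors are instances. *)
Record inner_product (R : realType) (V : lmodType R) (B : V -> V -> R) : Prop :=
  InnerProduct {
    innerC : forall x y, B x y = B y x;
    innerDl : forall x y z, B (x + y) z = B x z + B y z;
    innerZl : forall a x y, B (a *: x) y = a * B x y;
    inner_gt0 : forall x, x != 0 -> 0 < B x x }.

Section InnerProduct.
Variables (R : realType) (V : lmodType R) (B : V -> V -> R).
Hypothesis BP : inner_product B.
Implicit Types x y z u : V.

Lemma innerNl x y : B (- x) y = - B x y.
Proof. by rewrite -scaleN1r (innerZl BP) mulN1r. Qed.

Lemma innerBl x y z : B (x - y) z = B x z - B y z.
Proof. by rewrite (innerDl BP) innerNl. Qed.

Lemma inner0l y : B 0 y = 0.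
Proof. by rewrite -(scale0r 0) (innerZl BP) mul0r. Qed.

Lemma innerDr x y z : B x (y + z) = B x y + B x z.
Proof. by rewrite !(innerC BP x) (innerDl BP). Qed.

Lemma innerZr a x y : B x (a *: y) = a * B x y.
Proof. by rewrite !(innerC BP x) (innerZl BP). Qed.

Lemma innerBr x y z : B x (y - z) = B x y - B x z.
Proof. by rewrite !(innerC BP x) innerBl. Qed.

Lemma inner0r x : B x 0 = 0.
Proof. by rewrite (innerC BP) inner0l. Qed.

Lemma inner_ge0 x : 0 <= B x x.
Proof. by have [->|/(inner_gt0 BP)/ltW//] := eqVneq x 0; rewrite inner0l. Qed.

Lemma inner_suml (I : Type) (r : seq I) (P : pred I) (F : I -> V) y :
  B (\sum_(i <- r | P i) F i) y = \sum_(i <- r | P i) B (F i) y.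
Proof.
by apply: (big_morph (B^~ y)) => [u v|]; rewrite ?inner0l ?(innerDl BP).
Qed.

Lemma inner_sumr (I : Type) (r : seq I) (P : pred I) (F : I -> V) y :
  B y (\sum_(i <- r | P i) F i) = \sum_(i <- r | P i) B y (F i).
Proof.
by apply: (big_morph (B y)) => [u v|]; rewrite ?inner0r ?innerDr.
Qed.

Lemma cauchy_schwarz x y : B x y ^+ 2 <= B x x * B y y.
Proof.
have [->|/(inner_gt0 BP) y0] := eqVneq y 0; first by rewrite !inner0r expr0n/= mulr0.
have := inner_ge0 (B y y *: x - B x y *: y).
rewrite !(innerBl, innerBr, innerZr, innerZl BP) (innerC BP y x) => h.
rewrite -subr_ge0 -(pmulr_rge0 _ y0); apply: le_trans h _.
by rewrite le_eqVlt; apply/orP; left; apply/eqP; ring.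
Qed.

Lemma sqr_innerD_le x y : B (x + y) (x + y) <= 2 * B x x + 2 * B y y.
Proof.
have := inner_ge0 (x - y).
rewrite !(innerBl, innerBr, innerDr, innerDl BP) (innerC BP y x); lra.
Qed.

Definition reflection u x := x - (2 * B x u / B u u) *: u.

Lemma reflectionD u x y : reflection u (x + y) = reflection u x + reflection u y.
Proof.
by rewrite /reflection (innerDl BP) mulrDr mulrDl scalerDl opprD addrACA.
Qed.

Lemma reflectionZ u a x : reflection u (a *: x) = a *: reflection u x.
Proof.
rewrite /reflection (innerZl BP) scalerBr scalerA; congr (_ - _ *: _); ring.
Qed.

Lemma inner_reflection u x y : u != 0 ->
  B (reflection u x) (reflection u y) = B x y.
Proof.
move=> /(inner_gt0 BP)/gt_eqF/negbT u0.
rewrite /reflection !(innerBl, innerBr, innerZr, innerZl BP) (innerC BP u y).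
by field.
Qed.

Lemma reflectionK u : u != 0 -> involutive (reflection u).
Proof.
move=> /(inner_gt0 BP)/gt_eqF/negbT u0 x.
rewrite {1}/reflection {2}/reflection innerBl (innerZl BP).
rewrite /reflection -addrA -opprD -scalerDl.
rewrite (_ : 2 * _ / _ + _ = 0) ?scale0r ?subr0//; by field.
Qed.

Lemma reflection_swap x y : x != y -> B x x = B y y -> reflection (x - y) x = y.
Proof.
rewrite -subr_eq0 => /(inner_gt0 BP)/gt_eqF/negbT u0 xy.
rewrite /reflection (_ : 2 * _ / _ = 1).
  by rewrite scale1r opprB addrC subrK.
apply: (mulIf u0); rewrite mulfVK// mul1r.
rewrite !(innerBl, innerBr) (innerC BP y x) xy; ring.
Qed.

Lemma reflection_fix x y z : B z x = B z y -> reflection (x - y) z = z.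
Proof.
by move=> zxy; rewrite /reflection innerBr zxy subrr mulr0 mul0r scale0r subr0.
Qed.

(** Two families with the same Gram matrix are related by a product of
    reflections.  If [g] already sends [p j] to [q j] for the previous indices,
    the reflection exchanging [g (p i)] and [q i] fixes these [q j], because
    they have the same inner product with both vectors.  The class [Q] records
    what is kept of the product: being given by an orthogonal matrix, or being
    a bijective isometry. *)
Lemma gram_extension (Q : (V -> V) -> Prop) :
    Q id -> (forall g u, Q g -> u != 0 -> Q (reflection u \o g)) ->
    (forall g x y, Q g -> B (g x) (g y) = B x y) ->
  forall (I : eqType) (s : seq I) (p q : I -> V),
    {in s &, forall i j, B (p i) (p j) = B (q i) (q j)} ->
  exists2 g, Q g & {in s, forall i, g (p i) = q i}.
Proof.
move=> Qid Qrefl Qiso I s p q; elim: s => [|i s IH] gram; first by exists id.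
have [j k js ks|g Qg gpq] := IH.
  by apply: gram; rewrite inE ?js ?ks orbT.
have [gi|gi] := eqVneq (g (p i)) (q i).
  by exists g => // j; rewrite inE => /predU1P[->|/gpq].
exists (reflection (g (p i) - q i) \o g); first by apply: Qrefl; rewrite ?subr_eq0.
move=> j; rewrite inE => /predU1P[->|js] /=.
  by rewrite reflection_swap// Qiso// gram ?mem_head.
rewrite (gpq j js) reflection_fix// -{1}(gpq j js) Qiso// gram ?mem_head//.
by rewrite inE js orbT.
Qed.

End InnerProduct.

(** * Orthogonal matrices acting on row vectors *)

Section Matrices.
Variables (R : realType) (D : nat).
Implicit Types (u v w : 'rV[R]_D) (A G : 'M[R]_D).

Definition dotmx u v : R := \sum_k u 0 k * v 0 k.

Lemma dotmxE u v : (u *m v^T) 0 0 = dotmx u v.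
Proof. by rewrite mxE; apply: eq_bigr => k _; rewrite mxE. Qed.

Lemma dotmx_inner : inner_product dotmx.
Proof.
split.
- by move=> u v; apply: eq_bigr => k _; rewrite mulrC.
- by move=> u v w; rewrite -big_split; apply: eq_bigr => k _; rewrite mxE mulrDl.
- by move=> a u v; rewrite mulr_sumr; apply: eq_bigr => k _; rewrite mxE mulrA.
move=> u u0; rewrite lt_neqAle sumr_ge0 ?andbT => [|k _]; last by rewrite -expr2 sqr_ge0.
apply: contra u0 => /eqP/esym/psumr_eq0P u0; apply/eqP/rowP => k; rewrite mxE.
apply/eqP; rewrite -sqrf_eq0 expr2; apply/eqP/u0 => // i _.
by rewrite -expr2 sqr_ge0.
Qed.

Definition orthogonal_mx A := A *m A^T = 1%:M.

Lemma orthogonal_mx1 : orthogonal_mx 1%:M.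
Proof. by rewrite /orthogonal_mx trmx1 mulmx1. Qed.

Lemma orthogonal_mxM A G : orthogonal_mx A -> orthogonal_mx G -> orthogonal_mx (A *m G).
Proof.
by move=> Ao Go; rewrite /orthogonal_mx trmx_mul mulmxA -(mulmxA A) Go mulmx1.
Qed.

Lemma dotmx_orthogonal A u v : orthogonal_mx A -> dotmx (u *m A) (v *m A) = dotmx u v.
Proof. by move=> Ao; rewrite -!dotmxE trmx_mul mulmxA -(mulmxA u) Ao mulmx1. Qed.

(** The square of the Hilbert-Schmidt norm, chosen because it is invariant
    under left multiplication by orthogonal matrices and bounds the operator
    norm. *)
Definition hs_sqr A : R := \sum_i \sum_j A i j ^+ 2.

Lemma hs_sqrE A : hs_sqr A = \tr (A^T *m A).
Proof.
rewrite /hs_sqr exchange_big; apply: eq_bigr => j _; rewrite mxE.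
by apply: eq_bigr => i _; rewrite mxE expr2.
Qed.

Lemma hs_sqr_orthogonal G A : orthogonal_mx G -> hs_sqr (G *m A) = hs_sqr A.
Proof.
move=> /mulmx1C Go; rewrite !hs_sqrE trmx_mul mulmxA -(mulmxA A^T) Go.
by rewrite mulmx1.
Qed.

Lemma hs_sqrN A : hs_sqr (- A) = hs_sqr A.
Proof.
by apply: eq_bigr => i _; apply: eq_bigr => j _; rewrite mxE sqrrN.
Qed.

Lemma dotmx_mulmx_le v A : dotmx (v *m A) (v *m A) <= dotmx v v * hs_sqr A.
Proof.
rewrite /hs_sqr exchange_big mulr_sumr; apply: ler_sum => j _.
rewrite -expr2; have := cauchy_schwarz dotmx_inner v (col j A)^T.
congr (_ ^+ 2 <= _ * _); last by apply: eq_bigr => i _; rewrite !mxE expr2.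
by rewrite mxE; apply: eq_bigr => i _; rewrite !mxE.
Qed.

Lemma reflection_mx u : u != 0 ->
  exists2 A, orthogonal_mx A & forall x, reflection dotmx u x = x *m A.
Proof.
move=> u0; pose A := 1%:M - (2 / dotmx u u) *: (u^T *m u).
have AE x : reflection dotmx u x = x *m A.
  rewrite /A mulmxBr mulmx1 -scalemxAr mulmxA [x *m u^T]mx11_scalar mul_scalar_mx.
  by rewrite dotmxE scalerA mulrAC.
exists A => //; apply/matrixP => i j.
transitivity (dotmx (delta_mx 0 i *m A) (delta_mx 0 j *m A)).
  by rewrite -!rowE mxE; apply: eq_bigr => k _; rewrite !mxE.
rewrite -!AE (inner_reflection dotmx_inner)// mxE /dotmx (bigD1 i)//= big1.
  by rewrite !mxE !eqxx mul1r addr0 eq_sym.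
by move=> k /negPf ki; rewrite !mxE eqxx/= ki mul0r.
Qed.

Lemma gram_extension_mx (I : eqType) (s : seq I) (p q : I -> 'rV[R]_D) :
    {in s &, forall i j, dotmx (p i) (p j) = dotmx (q i) (q j)} ->
  exists2 A, orthogonal_mx A & {in s, forall i, p i *m A = q i}.
Proof.
move=> gram.
pose Q (g : 'rV[R]_D -> 'rV[R]_D) :=
  exists2 A, orthogonal_mx A & forall x, g x = x *m A.
have [|g u [A Ao gA] u0|g x y [A Ao gA]|g [A Ao gA] gpq] :=
    @gram_extension _ _ _ dotmx_inner Q _ _ _ I s p q gram.
- by exists 1%:M => [|x]; [exact: orthogonal_mx1|rewrite mulmx1].
- have [A' A'o A'E] := reflection_mx u0.
  by exists (A *m A') => [|x]; [exact: orthogonal_mxM|rewrite /= A'E gA mulmxA].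
- by rewrite !gA dotmx_orthogonal.
by exists A => // i /gpq; rewrite gA.
Qed.

(** At height [rho] above the hyperplane orthogonal to [E], translation by [-c]
    is nearly a rotation: reflecting in [E] and then in [2 rho E - c] moves
    [y + c + rho E] to [y + rho E] up to the multiple [kap u] of the second
    axis, of length [O(1 / rho)]. *)
Lemma translation_by_rotation (E c : 'rV[R]_D) (rho : R) :
    dotmx E E = 1 -> dotmx c E = 0 -> 0 < rho ->
  exists2 A, orthogonal_mx A & forall y, dotmx y E = 0 ->
    let err := (y + c + rho *: E) *m A - (y + rho *: E) in
    dotmx err err * (4 * rho ^+ 2) <= (dotmx c c + 2 * dotmx y c) ^+ 2.
Proof.
move=> E1 cE r0; have BP := dotmx_inner.
pose simp := (innerBl BP, innerBr BP, innerDr BP, innerZr BP, innerZl BP, innerDl BP, cE, E1).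
pose u := (2 * rho) *: E - c.
have Ec : dotmx E c = 0 by rewrite (innerC BP).
have uu : dotmx u u = 4 * rho ^+ 2 + dotmx c c by rewrite /u !simp Ec; ring.
have c0 := inner_ge0 BP c.
have uu0 : 0 < dotmx u u by rewrite uu; nra.
have u0 : u != 0 by apply: contraTneq uu0 => ->; rewrite inner0l// ltxx.
have E0 : E != 0 by apply: contra_eq_neq (E1) => ->; rewrite inner0l// eq_sym oner_neq0.
have [A1 A1o A1E] := reflection_mx E0; have [A2 A2o A2E] := reflection_mx u0.
exists (A1 *m A2); first exact: orthogonal_mxM.
move=> y yE; cbv zeta; set err := _ - _.
pose kap := (dotmx c c + 2 * dotmx y c) / dotmx u u.
have kapE : kap * dotmx u u = dotmx c c + 2 * dotmx y c.
  by rewrite /kap mulfVK ?lt0r_neq0.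
have -> : err = kap *: u.
  rewrite /err mulmxA -A1E -A2E.
  have -> : reflection dotmx E (y + c + rho *: E) = y + c - rho *: E.
    by rewrite /reflection !simp yE; apply/rowP => k; rewrite !mxE; field.
  rewrite /reflection.
  have -> : 2 * dotmx (y + c - rho *: E) u / dotmx u u = - (kap + 1).
    have uuN0 := lt0r_neq0 uu0; apply: (canLR (mulfK uuN0)).
    rewrite mulNr [(kap + 1) * _]mulrDl kapE uu /u !simp yE Ec; ring.
  by apply/rowP => k; rewrite /u !mxE; ring.
rewrite (innerZl BP) (innerZr BP) -[in leRHS]kapE [leRHS]expr2.
rewrite [leRHS]mulrAC.
have k2 : 0 <= kap * (kap * dotmx u u) by rewrite mulrA -expr2 mulr_ge0 ?sqr_ge0// ltW.
by rewrite ler_wpM2l// uu lerDl.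
Qed.

End Matrices.

Lemma dotmx_row_mx (R : realType) m n (u u' : 'rV[R]_m) (v v' : 'rV[R]_n) :
  dotmx (row_mx u v) (row_mx u' v') = dotmx u u' + dotmx v v'.
Proof. by rewrite -!dotmxE tr_row_mx mul_row_col mxE. Qed.

(** * Finite sets of rotations almost invariant under rotations *)

Section Nets.
Variables (R : realType) (D : nat).
Implicit Types (A G : 'M[R]_D) (eta : R).

Definition separated_rotations eta (T : finType) (p : T -> 'M[R]_D) :=
  (forall i, orthogonal_mx (p i)) /\
  (forall i j, i != j -> eta <= hs_sqr (p i - p j)).

Lemma orthogonal_mx_entry A i j : orthogonal_mx A -> A i j ^+ 2 <= 1.
Proof.
move=> /matrixP/(_ i i); rewrite !mxE eqxx => AA; rewrite -[leRHS]AA.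
rewrite (bigD1 j)//= !mxE -expr2 lerDl sumr_ge0// => k _.
by rewrite !mxE -expr2 sqr_ge0.
Qed.

(** Total boundedness of the orthogonal group: rounding the entries to
    multiples of [1/K] is injective on a separated family. *)
Lemma separated_rotations_bound eta : 0 < eta ->
  exists C, forall (T : finType) (p : T -> 'M[R]_D), separated_rotations eta p -> (#|T| <= C)%N.
Proof.
move=> eta0; pose K := (Num.truncn ((D * D)%:R / eta)).+1.
have K1 : 1 <= K%:R :> R by rewrite ler1n.
have DK : (D * D)%:R < eta * K%:R ^+ 2.
  have : (D * D)%:R / eta < K%:R by rewrite truncnS_gt.
  rewrite ltr_pdivrMr// => h; apply: lt_le_trans h _.
  by rewrite mulrC ler_pM2l//; nra.
pose cell (x : R) : 'I_(2 * K).+1 := inord (Num.truncn ((x + 1) * K%:R)).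
have cellP (x y : R) : x ^+ 2 <= 1 -> y ^+ 2 <= 1 -> cell x = cell y ->
    (x - y) ^+ 2 * K%:R ^+ 2 <= 1.
  move=> x1 y1 /(congr1 (@nat_of_ord _)).
  have bnd (z : R) : z ^+ 2 <= 1 ->
      0 <= (z + 1) * K%:R /\ (Num.truncn ((z + 1) * K%:R) < (2 * K).+1)%N.
    move=> z1; have z2 : z + 1 <= 2 by nra.
    have z0 : 0 <= (z + 1) * K%:R by rewrite mulr_ge0// ?ler0n//; nra.
    split=> //; rewrite truncn_lt_nat// -natr1 natrM; nra.
  have [x0 xK] := bnd _ x1; have [y0 yK] := bnd _ y1.
  rewrite /cell !inordK// => xy.
  have /andP[] := truncn_itv x0; have /andP[] := truncn_itv y0.
  rewrite xy -natr1; move: (_%:R) => t h1 h2 h3 h4.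
  rewrite -exprMn mulrBl; nra.
exists #|{ffun 'I_D * 'I_D -> 'I_(2 * K).+1}| => T p [po psep].
pose f i := [ffun kl => cell (p i kl.1 kl.2)].
rewrite -(card_codom (f := f)) ?max_card// => i j fij.
apply: contraTeq DK => /psep ij; rewrite -leNgt.
apply: le_trans (_ : hs_sqr (p i - p j) * K%:R ^+ 2 <= _).
  by rewrite ler_wpM2r// sqr_ge0.
have -> : (D * D)%:R = \sum_(k < D) \sum_(l < D) (1 : R).
  by rewrite !sumr_const !card_ord -mulrnA.
rewrite /hs_sqr mulr_suml; apply: ler_sum => k _.
rewrite mulr_suml; apply: ler_sum => l _.
rewrite !mxE; apply: cellP; try exact: orthogonal_mx_entry.
by move/ffunP: fij => /(_ (k, l)); rewrite !ffunE.
Qed.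

Lemma maximal_separated_rotations eta : 0 < eta ->
  exists M (p : 'I_M -> 'M[R]_D), [/\ (0 < M)%N, separated_rotations eta p
    & forall (T : finType) (q : T -> 'M[R]_D), separated_rotations eta q -> (#|T| <= M)%N].
Proof.
move=> eta0; have [C CP] := separated_rotations_bound eta0.
pose ok M := `[< exists p : 'I_M -> 'M[R]_D, separated_rotations eta p >].
have ok1 : ok 1%N.
  apply/asboolP; exists (fun=> 1%:M); split=> [_|i j]; first exact: orthogonal_mx1.
  by rewrite !ord1.
have okC M : ok M -> (M <= C)%N.
  by move=> /asboolP[p /CP]; rewrite card_ord.
have [M /asboolP[p psep] Mmax] := ex_maxnP (ex_intro _ 1%N ok1) okC.
exists M, p; split=> // [|T q [qo qsep]]; first exact: Mmax.
apply/Mmax/asboolP; exists (q \o enum_val); split=> [i|i j ij]; first exact: qo.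
by apply: qsep; rewrite (inj_eq enum_val_inj).
Qed.

(** A largest separated family plays the role of Haar measure.  For a set [S]
    of its members with set [T] of neighbours after rotation, the rotated
    members of [S] together with the members outside [T] are separated again;
    maximality gives [#|S| <= #|T|], which is the marriage condition. *)
Lemma rotation_matching eta M (p : 'I_M -> 'M[R]_D) G :
    separated_rotations eta p ->
    (forall (T : finType) (q : T -> 'M[R]_D), separated_rotations eta q -> (#|T| <= M)%N) ->
    orthogonal_mx G ->
  exists2 sigma : 'I_M -> 'I_M, injective sigma
    & forall i, hs_sqr (G *m p i - p (sigma i)) < eta.
Proof.
move=> [po psep] pmax Go.
pose r := [set ij | hs_sqr (G *m p ij.1 - p ij.2) < eta].
suff /hall_matching[f finj fr] : hall_condition r.
  by exists f => // i; have := fr i; rewrite inE.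
move=> S; set T := nbrs r S.
pose q (x : {i | i \in S} + {j | j \in ~: T}) :=
  match x with inl i => G *m p (val i) | inr j => p (val j) end.
have far i j : i \in S -> j \in ~: T -> eta <= hs_sqr (G *m p i - p j).
  move=> iS; rewrite !inE => /exists_inP jT; rewrite leNgt; apply/negP => ij.
  by apply: jT; exists i; rewrite ?inE.
have : separated_rotations eta q.
  split=> [[i|j]|[i|j] [i'|j']] /=; first by apply: orthogonal_mxM; rewrite ?po.
  - exact: po.
  - by move=> ii'; rewrite -mulmxBr hs_sqr_orthogonal// psep//.
  - by move=> _; apply: far; exact: valP.
  - by move=> _; rewrite -hs_sqrN opprB; apply: far; exact: valP.
  - by move=> jj'; apply: psep.
move/pmax; rewrite card_sum !card_sig.
rewrite -[X in (_ <= X)%N](card_ord M) -(cardsC T).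
by rewrite !cardsE leq_add2r.
Qed.

(** A congruence between two families in the hyperplane orthogonal to [E] is an
    orthogonal map fixing [E] followed by a translation, and the translation is
    replaced by a rotation at large height.  In this sense a congruence is a
    limit of elements of a compact group, although it does not lie in one. *)
Lemma congruence_by_rotation (E : 'rV[R]_D) (I : eqType) (s : seq I)
    (p q : I -> 'rV[R]_D) :
    dotmx E E = 1 ->
    {in s, forall i, dotmx (p i) E = 0} -> {in s, forall i, dotmx (q i) E = 0} ->
    {in s &, forall i j, dotmx (p i - p j) (p i - p j) = dotmx (q i - q j) (q i - q j)} ->
  exists C, forall rho, 0 < rho -> exists2 G, orthogonal_mx G &
    {in s, forall i, let err := (p i + rho *: E) *m G - (q i + rho *: E) in
      dotmx err err * (4 * rho ^+ 2) <= C}.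
Proof.
have BP := @dotmx_inner R D => E1.
case: s => [|i0 s0]; first by exists 0 => rho _; exists 1%:M => //; exact: orthogonal_mx1.
set s := i0 :: s0 => pE qE pq.
(* The index [None] stands for [E], which the orthogonal map has to fix. *)
pose P i := if i is Some i then p i - p i0 else E.
pose Q i := if i is Some i then q i - q i0 else E.
have i0s : i0 \in s by rewrite mem_head.
have polar (u v w : 'rV[R]_D) : dotmx (u - w) (v - w) =
    (dotmx (u - w) (u - w) + dotmx (v - w) (v - w) - dotmx (u - v) (u - v)) / 2.
  by rewrite !(innerBl BP, innerBr BP) (innerC BP w u) (innerC BP w v) (innerC BP v u); field.
have [|A Ao AP] := @gram_extension_mx R D (option I) (None :: map Some s) P Q.
  have inP k : k \in None :: map Some s -> k = None \/ exists2 i, i \in s & k = Some i.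
    by rewrite in_cons => /predU1P[->|/mapP[i si ->]]; [left|right; exists i].
  move=> i j /inP[->|[i' i's ->]] /inP[->|[j' j's ->]] //=.
  - by rewrite !(innerBr BP) !(innerC BP E) !pE ?qE// subrr.
  - by rewrite !(innerBl BP) !pE ?qE// subrr.
  - by rewrite polar [RHS]polar !pq.
have EA : E *m A = E := AP None (mem_head _ _).
pose c := p i0 *m A - q i0.
have pA i : i \in s -> p i *m A = q i + c.
  move=> si; have := AP (Some i); rewrite inE map_f//= mulmxBl => /(_ isT) h.
  by rewrite /c addrCA -h addrC subrK.
have cE : dotmx c E = 0.
  by rewrite /c (innerBl BP) qE// -EA dotmx_orthogonal// pE// subrr.
exists (\sum_(i <- s) (dotmx c c + 2 * dotmx (q i) c) ^+ 2) => rho r0.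
have [A' A'o A'P] := translation_by_rotation E1 cE r0.
exists (A *m A'); first exact: orthogonal_mxM.
move=> i si /=; rewrite mulmxA mulmxDl -scalemxAl EA pA//.
apply: le_trans (A'P _ (qE _ si)) _.
by rewrite (big_rem i)//= lerDl sumr_ge0// => j _; rewrite sqr_ge0.
Qed.

End Nets.

Local Open Scope classical_set_scope.
Local Open Scope ring_scope.

(** * Isometries and orthonormal families in the Hilbert space *)

Section Hilbert.
Variables (R : realType) (H : normedModType R) (ip : {dot H for (idfun : R -> R)}).
Hypothesis ip_norm : induces_norm ip.

Lemma ip_inner : inner_product ip.
Proof.
split=> [x y|x y z|a x y|x x0].
- by rewrite (hermC ip) expr0 mul1r.
- exact: linearDl.
- exact: linearZl_LR.
by rewrite ip_norm exprn_gt0 ?normr_gt0.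
Qed.
Let BP := ip_inner.

(** Homogeneity of the space: after moving base points to the origin, distances
    determine inner products by polarization, and [gram_extension] applies. *)
Lemma isometry_extension (I : eqType) (s : seq I) (p q : I -> H) :
    {in s &, forall i j, `|p i - p j| = `|q i - q j|} ->
  exists2 g, onto_isometry g & {in s, forall i, g (p i) = q i}.
Proof.
case: s => [|i0 s0].
  by exists id => //; split=> // y _; exists y.
set s := i0 :: s0 => pq; have i0s : i0 \in s by rewrite mem_head.
pose Q (g : H -> H) := [/\ {morph g : x y / x - y}, forall x y, ip (g x) (g y) = ip x y
  & forall y, exists x, g x = y].
have polar (u v w : H) : ip (u - w) (v - w) =
    (`|u - w| ^+ 2 + `|v - w| ^+ 2 - `|u - v| ^+ 2) / 2.
  by rewrite -!ip_norm !(innerBl BP, innerBr BP) (innerC BP w u) (innerC BP w v) (innerC BP v u); field.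
have [||g x y [_ + _]|j k js ks|g [gB giso gsurj] gpq] := @gram_extension _ _ _ BP Q _ _ _ I s
    (fun i => p i - p i0) (fun i => q i - q i0).
- by split=> // y; exists y.
- move=> g u [gB giso gsurj] u0; split=> [x y|x y|y] /=.
  + by rewrite gB reflectionD// -scaleN1r reflectionZ// scaleN1r.
  + by rewrite inner_reflection.
  + by have [x gx] := gsurj (reflection ip u y); exists x; rewrite gx reflectionK.
- by apply.
- by rewrite !polar !pq.
exists (fun x => q i0 + g (x - p i0)); last by move=> i si; rewrite gpq// addrC subrK.
split=> [x y|y _].
  apply: (@pexpIrn _ 2); rewrite ?nnegrE// -!ip_norm opprD addrACA subrr add0r.
  by rewrite -gB giso opprB addrA subrK.
have [x gx] := gsurj (y - q i0); exists (x + p i0) => //.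
by rewrite addrK gx addrC subrK.
Qed.

Definition orthonormal_family (I : eqType) (b : I -> H) :=
  forall i j, ip (b i) (b j) = (i == j)%:R.

Definition projection n (b : 'I_n -> H) x := \sum_i ip x (b i) *: b i.

Lemma projection_orthogonal n (b : 'I_n -> H) x j : orthonormal_family b ->
  ip (x - projection b x) (b j) = 0.
Proof.
move=> bo; rewrite (innerBl BP) (inner_suml BP) (bigD1 j)//= big1 => [|i /negPf ij].
  by rewrite (innerZl BP) bo eqxx mulr1 addr0 subrr.
by rewrite (innerZl BP) bo ij mulr0.
Qed.

(** The new vector goes to index [ord0], where [big_ord_recl] isolates it. *)
Definition extend_family n (u : H) (b : 'I_n -> H) (i : 'I_n.+1) : H :=
  oapp b u (unlift ord0 i).

Lemma extend_family0 n u (b : 'I_n -> H) : extend_family u b ord0 = u.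
Proof. by rewrite /extend_family unlift_none. Qed.

Lemma extend_familyS n u (b : 'I_n -> H) i : extend_family u b (lift ord0 i) = b i.
Proof. by rewrite /extend_family liftK. Qed.

Lemma extend_orthonormal n u (b : 'I_n -> H) : orthonormal_family b ->
    ip u u = 1 -> (forall i, ip u (b i) = 0) ->
  orthonormal_family (extend_family u b).
Proof.
move=> bo u1 ub i j; case: (unliftP ord0 i) => [i'|] ->;
  case: (unliftP ord0 j) => [j'|] ->; rewrite ?extend_family0 ?extend_familyS.
- by rewrite bo (inj_eq lift_inj).
- by rewrite (innerC BP) ub.
- by rewrite ub.
- by rewrite u1.
Qed.

Lemma extend_by_residual n (b : 'I_n -> H) x : orthonormal_family b ->
    x - projection b x != 0 ->
  exists2 u, orthonormal_family (extend_family u b)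
    & x = projection (extend_family u b) x.
Proof.
move=> bo; set r := x - _ => r0.
have nr0 : `|r| != 0 by rewrite normr_eq0.
exists (`|r|^-1 *: r).
  apply: extend_orthonormal => // [|i].
    by rewrite (innerZl BP) (innerZr BP) ip_norm; field.
  by rewrite (innerZl BP) projection_orthogonal// mulr0.
have xr : ip x r = `|r| ^+ 2.
  rewrite -ip_norm {1}(_ : x = r + projection b x); last by rewrite subrK.
  rewrite (innerDl BP) (inner_suml BP) big1 ?addr0// => i _.
  by rewrite (innerZl BP) (innerC BP _ r) projection_orthogonal// mulr0.
rewrite /projection big_ord_recl extend_family0.
under eq_bigr do rewrite extend_familyS.
rewrite (innerZr BP) xr scalerA [X in X *: r](_ : _ = 1); last by field.
by rewrite scale1r subrK.
Qed.

Lemma projection_extend n (b : 'I_n -> H) u x : orthonormal_family (extend_family u b) ->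
  x = projection b x -> x = projection (extend_family u b) x.
Proof.
move=> bo xb; rewrite /projection big_ord_recl extend_family0.
under eq_bigr do rewrite extend_familyS.
rewrite -/(projection b x) -xb [ip x u](_ : _ = 0) ?scale0r ?add0r//.
rewrite xb (inner_suml BP) big1// => i _.
by have := bo (lift ord0 i) ord0; rewrite extend_family0 extend_familyS (innerZl BP) => ->;
   rewrite mulr0.
Qed.

Lemma gram_schmidt (W : seq H) :
  exists n (b : 'I_n -> H), orthonormal_family b /\ {in W, forall x, x = projection b x}.
Proof.
elim: W => [|y W [n [b [bo bW]]]].
  by exists 0%N, (fun=> 0); split=> // -[].
have [yb|yb] := eqVneq (y - projection b y) 0.
  exists n, b; split=> // x; rewrite inE => /predU1P[->|/bW//].
  by apply/eqP; rewrite -subr_eq0 yb.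
have [u uo yu] := extend_by_residual bo yb.
exists n.+1, (extend_family u b); split=> // x; rewrite inE => /predU1P[-> //|/bW].
exact: projection_extend.
Qed.

(** The points of [W] are recorded by their coordinates in an orthonormal basis
    of their span; one further coordinate provides the direction [E]. *)
Lemma coordinates (W : seq H) :
  exists D (phi : H -> 'rV[R]_D) (E : 'rV[R]_D),
    [/\ dotmx E E = 1, {in W &, forall x y, dotmx (phi x) (phi y) = ip x y}
      & {in W, forall x, dotmx (phi x) E = 0}].
Proof.
have [n [b [bo bW]]] := gram_schmidt W.
exists (n + 1)%N, (fun x => row_mx (\row_k ip x (b k)) 0), (row_mx 0 1%:M).
have BR k := @dotmx_inner R k.
split=> [|x y /bW xW /bW yW|x _]; rewrite dotmx_row_mx.
- rewrite (inner0l (BR _)) add0r /dotmx big_ord1 mxE eqxx mulr1 //.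
- rewrite (inner0l (BR _)) addr0 [in RHS]xW (inner_suml BP); apply: eq_bigr => k _.
  by rewrite !mxE (innerZl BP) (innerC BP y).
- by rewrite (inner0r (BR _)) (inner0l (BR _)) addr0.
Qed.

Hypothesis H_infdim : infinite_dimensional H.

Lemma orthonormal_exists n : exists b : 'I_n -> H, orthonormal_family b.
Proof.
elim: n => [|n [b bo]]; first by exists (fun=> 0) => -[].
have [x xb] : exists x, x - projection b x != 0.
  apply: contrapT => none; apply: H_infdim; exists n, b => x.
  exists (fun i => ip x (b i)); apply/eqP; rewrite -subr_eq0.
  by apply: contrapT => /negP xb; apply: none; exists x.
by have [u uo _] := extend_by_residual bo xb; exists (extend_family u b).
Qed.

(** The normalized orthogonal sum of [N] copies of [R^D] embeds isometrically:
    the coordinates of the blocks are spread over [N * D] orthonormal vectors. *)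
Lemma block_embedding N D : (0 < N)%N ->
  exists f : ('I_N -> 'rV[R]_D) -> H, forall v w,
    `|f v - f w| ^+ 2 = N%:R^-1 * \sum_i dotmx (v i - w i) (v i - w i).
Proof.
move=> N0; have [b0 b0o] := orthonormal_exists #|{: 'I_N * 'I_D}|.
pose b ik := b0 (enum_rank ik).
have bo : orthonormal_family b by move=> i j; rewrite b0o (inj_eq enum_rank_inj).
pose f0 (v : 'I_N -> 'rV[R]_D) := \sum_ik v ik.1 0 ik.2 *: b ik.
have f0B v w : f0 v - f0 w = f0 (fun i => v i - w i).
  rewrite /f0 -sumrB; apply: eq_bigr => ik _.
  by rewrite -scalerBl !mxE.
have f0n v : ip (f0 v) (f0 v) = \sum_i dotmx (v i) (v i).
  rewrite /dotmx pair_bigA /= {1}/f0 (inner_suml BP); apply: eq_bigr => -[i k] _.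
  rewrite (innerZl BP) (inner_sumr BP) (bigD1 (i, k))//= (innerZr BP) bo eqxx mulr1.
  rewrite big1 ?addr0// => jl /negPf ne.
  by rewrite (innerZr BP) bo eq_sym ne mulr0.
exists (fun v => (Num.sqrt N%:R)^-1 *: f0 v) => v w.
rewrite -scalerBr f0B normrZ exprMn -ip_norm f0n; congr (_ * _).
by rewrite ger0_norm ?invr_ge0 ?sqrtr_ge0// exprVn sqr_sqrtr.
Qed.

End Hilbert.

(** * Words of rotations *)

(** The difference is split through [z *m G *m P i] and [z *m P j]; the three
    terms account for [G] sending [z] only near [z'], for [P j] being only near
    [G *m P i], and for the letters [j] and [k] being different. *)
Lemma letter_estimate (R : realType) D (I : eqType) (P : I -> 'M[R]_D)
    (G : 'M[R]_D) (z z' : 'rV[R]_D) i j k : (forall i, orthogonal_mx (P i)) ->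
  dotmx (z' *m P i - z *m P k) (z' *m P i - z *m P k) <=
    2 * dotmx (z *m G - z') (z *m G - z') + 4 * dotmx z z * hs_sqr (G *m P i - P j)
    + 16 * dotmx z z * (j != k)%:R.
Proof.
move=> Po; have BP := @dotmx_inner R D; have z0 := inner_ge0 BP z.
set err := z *m G - z'.
have -> : z' *m P i - z *m P k =
    - (err *m P i) + (z *m (G *m P i - P j) + (z *m P j - z *m P k)).
  rewrite mulmxBr /err mulmxBl mulmxA; apply/rowP => l; rewrite !mxE; ring.
have h1 := sqr_innerD_le BP (- (err *m P i)) (z *m (G *m P i - P j) + (z *m P j - z *m P k)).
have h2 := sqr_innerD_le BP (z *m (G *m P i - P j)) (z *m P j - z *m P k).
have h3 := dotmx_mulmx_le z (G *m P i - P j).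
have h4 : dotmx (z *m P j - z *m P k) (z *m P j - z *m P k) <= 4 * dotmx z z * (j != k)%:R.
  have [->|_] := eqVneq j k; first by rewrite subrr inner0l// mulr0.
  have := sqr_innerD_le BP (z *m P j) (- (z *m P k)).
  rewrite !(innerNl BP) (innerC BP _ (- _)) (innerNl BP) opprK !dotmx_orthogonal//.
  by rewrite mulr1; lra.
move: h1; rewrite (innerNl BP) (innerC BP _ (- _)) (innerNl BP) opprK dotmx_orthogonal//.
lra.
Qed.

Lemma word_estimate (R : realType) D M N (P : 'I_M -> 'M[R]_D) (G : 'M[R]_D)
    (sigma : 'I_M -> 'I_M) (z z' : 'rV[R]_D) (a eta delta : R) (x0 : 'I_M) (s t : seq 'I_M) :
    (0 < N)%N -> size s = N -> size t = N -> (forall i, orthogonal_mx (P i)) ->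
    dotmx (z *m G - z') (z *m G - z') <= a ->
    (forall i, hs_sqr (G *m P i - P (sigma i)) <= eta) ->
    (hamming (map sigma s) t)%:R <= delta * N%:R ->
  N%:R^-1 * \sum_(i < N)
     dotmx (z' *m P (nth x0 s i) - z *m P (nth x0 t i))
           (z' *m P (nth x0 s i) - z *m P (nth x0 t i))
  <= 2 * a + 4 * dotmx z z * eta + 16 * dotmx z z * delta.
Proof.
move=> N0 sN tN Po za Pe st; have z0 := inner_ge0 (@dotmx_inner R D) z.
have NR0 : 0 < N%:R :> R by rewrite ltr0n.
rewrite ler_pdivrMl//.
apply: (@le_trans _ _ (\sum_(i < N) (2 * a + 4 * dotmx z z * eta +
   16 * dotmx z z * (sigma (nth x0 s i) != nth x0 t i)%:R))).
  apply: ler_sum => i _; apply: le_trans (letter_estimate G z z' _ (sigma (nth x0 s i)) _ Po) _.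
  rewrite lerD2r lerD//; first by rewrite ler_pM2l.
  by rewrite ler_wpM2l// mulr_ge0.
rewrite big_split /= sumr_const card_ord -mulr_sumr -natr_sum.
have -> : (\sum_(i < N) (sigma (nth x0 s i) != nth x0 t i) = hamming (map sigma s) t)%N.
  rewrite (@hamming_sum _ N (sigma x0))// ?size_map//.
  by apply: eq_bigr => i _; rewrite (nth_map x0) ?sN// (set_nth_default x0 (sigma x0)) ?tN.
rewrite -mulr_natl; nra.
Qed.

(** * Approximately monochromatic congruent families *)

Theorem corollary6p16 (R : realType) (H : completeNormedModType R)
    (ip : {dot H for (idfun : R -> R)}) (ip_norm : induces_norm ip)
    (H_infdim : infinite_dimensional H)
    (F : {fset H})
    (gamma : set (set {ffun F -> H})) (gammaP : finite_colouring gamma)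
    (Y : set {ffun F -> H}) (Y_fin : finite_set Y) (Y_emb : Y `<=` embeddings F)
    (e : R) (e_gt0 : 0 < e) :
  exists Y' : set {ffun F -> H},
    [/\ Y' `<=` embeddings F, congruent Y Y' & monochromatic_up_to gamma e Y'].
Proof.
have [/finite_seqP[gs gsE] [gcov _ _]] := gammaP.
have /finite_seqP[ys ysE] := Y_fin.
pose L : finType := 'I_(size ys).
(* The inclusion of [F], with index [None], is the embedding to which the
   members of [Y] are compared. *)
pose j0 : {ffun F -> H} := [ffun x => val x].
pose J (l : option L) : {ffun F -> H} := if l is Some l then nth j0 ys l else j0.
have Jemb l : embeddings F (J l).
  case: l => [l|] /=; last by move=> x y; rewrite !ffunE.
  by apply: Y_emb; rewrite ysE /= mem_nth.
pose pt (lx : option L * F) := J lx.1 lx.2.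
have [D [phi [E [E1 phiG phiE]]]] := coordinates ip_norm (map pt (enum predT)).
have ptW lx : pt lx \in map pt (enum predT) by rewrite map_f ?mem_enum.
have BP := @dotmx_inner R D; have BH := ip_inner ip_norm.
have phiB a b : dotmx (phi (pt a) - phi (pt b)) (phi (pt a) - phi (pt b)) = `|pt a - pt b| ^+ 2.
  by rewrite -ip_norm !(innerBl BP, innerBr BP, innerBl BH, innerBr BH) !phiG.
(* At every height [rho] the members of [Y] are rotations of [F] up to an error
   of squared length [C l / (4 rho ^ 2)]. *)
have /choice[C CP] (l : L) : exists C, forall rho, 0 < rho -> exists2 G, orthogonal_mx G &
    forall x, let err := (phi (pt (None, x)) + rho *: E) *m G - (phi (pt (Some l, x)) + rho *: E) in
      dotmx err err * (4 * rho ^+ 2) <= C.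
  have [|||c cP] := @congruence_by_rotation R D E F (enum predT)
    (fun x => phi (pt (None, x))) (fun x => phi (pt (Some l, x))) E1.
  - by move=> x _; rewrite phiE.
  - by move=> x _; rewrite phiE.
  - by move=> x y _ _; rewrite !phiB /pt !Jemb.
  exists c => rho /cP[G Go GP]; exists G => // x; apply: GP; exact: mem_enum.
pose Cmax := \sum_l `|C l|.
have Cmax0 : 0 <= Cmax by apply: sumr_ge0.
have leC l : C l <= Cmax.
  by rewrite /Cmax (bigD1 l)//= (le_trans (ler_norm _))// lerDl sumr_ge0.
(* The height [rho] makes the squared rotation error at most [e ^ 2 / 8]; with
   [eta] and [delta] below, each of the three terms of [word_estimate] is at
   most [e ^ 2 / 4], which leaves the sum below [e ^ 2]. *)
pose rho := 1 + 2 * Cmax / e ^+ 2.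
have e2 : 0 < e ^+ 2 by rewrite exprn_gt0.
have rho1 : 1 <= rho by rewrite lerDl divr_ge0 ?mulr_ge0// ltW.
have rhoC : 2 * Cmax <= e ^+ 2 * rho ^+ 2.
  have : 2 * Cmax <= e ^+ 2 * rho by rewrite mulrDr mulr1 mulrCA mulfV ?mulr1 ?gt_eqF// lerDr ltW.
  move=> h; apply: le_trans h _; rewrite ler_pM2l//; nra.
have rho0 : 0 < rho by lra.
pose z lx := phi (pt lx) + rho *: E.
have /choice[G GP] (l : L) : exists G, orthogonal_mx G /\ forall x,
    let err := z (None, x) *m G - z (Some l, x) in dotmx err err * (4 * rho ^+ 2) <= C l.
  by have [G Go GP] := CP l rho rho0; exists G.
pose Z := 1 + \sum_x dotmx (z (None, x)) (z (None, x)).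
have sumz0 : 0 <= \sum_x dotmx (z (None, x)) (z (None, x)).
  by apply: sumr_ge0 => x _; exact: inner_ge0 BP _.
have Z0 : 0 < Z by rewrite /Z; lra.
have leZ x : dotmx (z (None, x)) (z (None, x)) <= Z.
  rewrite /Z (bigD1 x)//= addrCA lerDl addr_ge0// sumr_ge0// => y _.
  exact: inner_ge0 BP _.
pose eta := e ^+ 2 / (16 * Z); pose delta := e ^+ 2 / (64 * Z).
have eta0 : 0 < eta by rewrite divr_gt0 ?mulr_gt0.
have delta0 : 0 < delta by rewrite divr_gt0 ?mulr_gt0.
have [M [P [M0 Psep Pmax]]] := maximal_separated_rotations D eta0.
have Po := Psep.1.
have /choice[sigma sigmaP] (l : L) : exists sigma : 'I_M -> 'I_M, injective sigma /\
    forall i, hs_sqr (G l *m P i - P (sigma i)) < eta.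
  by have [sigma inj close] := rotation_matching Psep Pmax (GP l).1; exists sigma.
pose N := (Num.truncn (#|L|%:R * ((size gs)%:R + 1) / delta ^+ 2)).+1.
have large : #|L|%:R * ((size gs)%:R + 1) < delta ^+ 2 * N%:R.
  by rewrite [ltRHS]mulrC -ltr_pdivrMr ?exprn_gt0// truncnS_gt.
have N0 : (0 < N)%N by [].
have [f fP] := @block_embedding R H ip ip_norm H_infdim N D N0.
pose x0 : 'I_M := Ordinal M0.
(* A word [s] acts on block [i] by the rotation named by its letter [i].  The
   default letter [x0] lets every word, of whatever length, have a colour. *)
pose T (s : seq 'I_M) lx := f (fun i => z lx *m P (nth x0 s i)).
have Tdist s a b : `|T s a - T s b| = `|pt a - pt b|.
  apply: (@pexpIrn _ 2); rewrite ?nnegrE// fP -phiB.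
  rewrite (eq_bigr (fun=> dotmx (phi (pt a) - phi (pt b)) (phi (pt a) - phi (pt b)))).
    by rewrite sumr_const card_ord -[dotmx _ _ *+ N]mulr_natl mulKf// pnatr_eq0.
  by move=> i _; rewrite -mulmxBl dotmx_orthogonal// /z opprD addrACA subrr addr0.
pose emb s : {ffun F -> H} := [ffun x => T s (None, x)].
have embP s : embeddings F (emb s).
  by move=> x y; rewrite !ffunE Tdist /pt /= !ffunE.
have /choice[col colP] s : exists c : 'I_(size gs), nth set0 gs c (emb s).
  have := embP s; rewrite -gcov => -[A gA As].
  have Ags : A \in gs by move: gA; rewrite gsE.
  have iA : (index A gs < size gs)%N by rewrite index_mem.
  by exists (Ordinal iA); rewrite /= nth_index.
have M0' : (0 < #|'I_M|)%N by rewrite card_ord.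
have [c [s sN sP]] := monochromatic_word M0' col delta0 large (fun l => (sigmaP l).1).
have [|g [giso gsurj] gP] := @isometry_extension R H ip ip_norm _ (enum predT) pt (T s).
  by move=> a b _ _; rewrite Tdist.
exists [set [ffun x => g (j x)] | j in Y]; split.
- by move=> _ [j /Y_emb jemb <-] x y; rewrite !ffunE giso jemb.
- by exists g.
exists (nth set0 gs c); first by rewrite gsE /= mem_nth.
move=> _ [j Yj <-]; split; first by move=> x y; rewrite !ffunE giso (Y_emb _ Yj).
have jys : j \in ys by move: Yj; rewrite ysE.
have ij : (index j ys < size ys)%N by rewrite index_mem.
pose l : L := Ordinal ij.
have jE x : j x = pt (Some l, x) by rewrite /pt /= nth_index.
have [t [tN tc tham]] := sP l.
exists (emb t); first by rewrite -tc.
rewrite /d_sup; apply: bigmax_lt => // x _.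
rewrite !ffunE jE gP ?mem_enum// distrC -(@ltr_pXn2r _ 2) ?nnegrE ?(ltW e_gt0)// /T fP.
have := @word_estimate R D M N P (G l) (sigma l) (z (None, x)) (z (Some l, x))
   (e ^+ 2 / 8) eta delta x0 s t N0 sN tN Po _ _ tham.
move=> /(_ _ _)/le_lt_trans; apply.
- have /= h := (GP l).2 x.
  rewrite -(@ler_pM2r _ (4 * rho ^+ 2)) ?mulr_gt0 ?exprn_gt0//.
  apply: le_trans h (le_trans (leC l) _); lra.
- by move=> i; apply/ltW/(sigmaP l).2.
have ez : dotmx (z (None, x)) (z (None, x)) * (e ^+ 2 / Z) <= e ^+ 2.
  by rewrite mulrCA ger_pMr// ler_pdivrMr// mul1r.
have -> : eta = (e ^+ 2 / Z) / 16 by rewrite /eta; field; rewrite gt_eqF.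
have -> : delta = (e ^+ 2 / Z) / 64 by rewrite /delta; field; rewrite gt_eqF.
lra.
Qed.
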